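(* Consider the many-body integrator $$\bm q_{A\,n+1}-\bm q_{A\,n}=\Delta t_n\sum_{B=1}^N m^{-1}_{AB}\,\bm p^B_{n+\frac12},\qquad \bm p^A_{n+1}-\bm p^A_n=-\sum_{B\ne A}\bm f^{AB}_{\square},\qquad A=1,\dots,N,$$ where $\Delta t_n=t_{n+1}-t_n$ and the algorithmic force $\bm f^{AB}_\square$ is any one of $\bm f^{AB}_{\mathrm{mp}}$ (mid-point), $\bm f^{AB}_{\mathrm{lg}}$ (LaBudde-Greenspan), $\bm f^{AB}_{\mathrm{ge}}$ (generalized Eyre), $\bm f^{AB}_{\mathrm{pm}}$ (perturbed mid-point), $\bm f^{AB}_{\mathrm{pt}}$ (perturbed trapezoidal) defined in the context. Then each of these five integrators conserves the linear momentum and the center of mass: every solution $(\bm q_{n+1},\bm p_{n+1})$ of the step from $(\bm q_n,\bm p_n)$ satisfies $$\bm L(\bm q_{n+1},\bm p_{n+1})=\bm L(\bm q_n,\bm p_n)\qquad\text{and}\qquad \bm C(\bm q_{n+1},\bm p_{n+1},t_{n+1})=\bm C(\bm q_n,\bm p_n,t_n).$$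
   Context: There are $N$ particles with positions $\bm q_A\in\mathbb R^3$ and momenta $\bm p^A\in\mathbb R^3$; $\bm q=(\bm q_1,\dots,\bm q_N)$, $\bm p=(\bm p^1,\dots,\bm p^N)$. The mass matrix $(m^{AB})_{A,B=1}^N$ is a constant real symmetric positive definite matrix and $m^{-1}_{AB}$ are the entries of its inverse. $\Delta t_n>0$. Linear momentum: $\bm L(\bm q,\bm p):=\sum_{A=1}^N\bm p^A$. Center of mass: $\bm C(\bm q,\bm p,t):=\left(\sum_{A,B=1}^N m^{AB}\bm q_B-t\,\bm L(\bm q,\bm p)\right)\Big/\sum_{A,B=1}^N m^{AB}$. Pair potentials $\hat V_{AB}:(0,\infty)\to\mathbb R$ for $A\neq B$ satisfy $\hat V_{AB}=\hat V_{BA}$, and are split, symmetrically in $A,B$, as $\hat V_{AB}=\hat V_{AB\,\mathrm c}+\hat V_{AB\,\mathrm e}$ (twice differentiable, $\hat V_{AB\,\mathrm c}''\ge0$, $\hat V_{AB\,\mathrm e}''\le0$) and as $\hat V_{AB}=\hat V_{AB+}+\hat V_{AB-}$ (four times differentiable, $\hat V_{AB+}^{(4)}\ge0$, $\hat V_{AB-}^{(4)}\le0$). Notation: $\bm q_{A\,n+\frac12}:=\frac12(\bm q_{A\,n}+\bm q_{A\,n+1})$, $\bm p^A_{n+\frac12}:=\frac12(\bm p^A_n+\bm p^A_{n+1})$, $d_{AB\,n}:=\|\bm q_{A\,n}-\bm q_{B\,n}\|$, $d_{AB\,n+1}:=\|\bm q_{A\,n+1}-\bm q_{B\,n+1}\|$,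 $d_{AB\,m}:=\|\bm q_{A\,n+\frac12}-\bm q_{B\,n+\frac12}\|$. Abbreviate $d=d_{AB\,n}$, $d'=d_{AB\,n+1}$, $\bm e_{AB}:=\bm q_{A\,n+\frac12}-\bm q_{B\,n+\frac12}$. The algorithmic forces are $$\bm f^{AB}_{\mathrm{mp}}:=\Delta t_n\hat V_{AB}'(d_{AB\,m})\frac{\bm e_{AB}}{d_{AB\,m}},\qquad \bm f^{AB}_{\mathrm{lg}}:=2\Delta t_n\frac{\hat V_{AB}(d')-\hat V_{AB}(d)}{d'-d}\,\frac{\bm e_{AB}}{d'+d},$$ $$\bm f^{AB}_{\mathrm{ge}}:=2\Delta t_n\left(\hat V_{AB\,\mathrm c}'(d')+\hat V_{AB\,\mathrm e}'(d)\right)\frac{\bm e_{AB}}{d'+d},$$ $$\bm f^{AB}_{\mathrm{pm}}:=2\Delta t_n\left(\hat V_{AB}'\left(\tfrac{d'+d}{2}\right)+\frac{(d'-d)^2}{24}\left(\hat V_{AB+}'''(d')+\hat V_{AB-}'''(d)\right)\right)\frac{\bm e_{AB}}{d'+d},$$ $$\bm f^{AB}_{\mathrm{pt}}:=2\Delta t_n\left(\frac{\hat V_{AB}'(d')+\hat V_{AB}'(d)}{2}-\frac{(d'-d)^2}{12}\left(\hat V_{AB+}'''(d)+\hat V_{AB-}'''(d')\right)\right)\frac{\bm e_{AB}}{d'+d}.$$ It is understood that all these expressions are well defined, i.e. $d_{AB\,n},d_{AB\,n+1}>0$ for all $A\ne B$, and additionally $d_{AB\,m}>0$ for the mid-point integrator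 and $d_{AB\,n+1}\neq d_{AB\,n}$ for the LaBudde-Greenspan integrator. *)

(* Defs.v *)
From HB Require Import structures.
From mathcomp Require Import all_boot all_order all_algebra.
From mathcomp Require Import all_classical all_reals all_analysis.

Set Implicit Arguments.
Unset Strict Implicit.
Unset Printing Implicit Defensive.

Import Order.TTheory GRing.Theory Num.Theory.
Import numFieldNormedType.Exports.

Local Open Scope ring_scope.

(* The library norm `|v| on 'rV[R]_3 is the sup norm, so the Euclidean norm is
   spelled out. *)
Definition enorm (R : realType) (v : 'rV[R]_3) : R :=
  Num.sqrt (\sum_(i < 3) v 0 i ^+ 2).

Definition posdefmx (R : realType) (N : nat) (m : 'M[R]_N) : Prop :=
  forall x : 'rV[R]_N, x != 0 -> 0 < (x *m m *m x^T) 0 0.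

(* k-fold differentiability on the open half-line (0, +oo). Potentials are
   represented by total functions R -> R; only their restrictions to (0, +oo)
   are ever constrained or used, and since that set is open, the derivatives
   there do not depend on the values taken elsewhere. *)
Definition differentiable_pos (R : realType) (k : nat) (f : R -> R) : Prop :=
  forall (j : nat) (x : R), (j < k)%N -> 0 < x -> derivable (derive1n j f) x 1.

(* Suffixes: _c / _e are the parts with second derivative of constant sign,
   _p / _m (for + / -) those with fourth derivative of constant sign. *)
Record potentials (R : realType) (N : nat) := Potentials {
  Vhat   : 'I_N -> 'I_N -> R -> R;
  Vhat_c : 'I_N -> 'I_N -> R -> R;
  Vhat_e : 'I_N -> 'I_N -> R -> R;
  Vhat_p : 'I_N -> 'I_N -> R -> R;
  Vhat_m : 'I_N -> 'I_N -> R -> R }.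

Definition pair_symmetric (R : realType) (N : nat)
    (W : 'I_N -> 'I_N -> R -> R) : Prop :=
  forall (A B : 'I_N) (x : R), A != B -> 0 < x -> W A B x = W B A x.

Definition convex_concave_split (R : realType) (N : nat)
    (P : potentials R N) : Prop :=
  [/\ pair_symmetric (Vhat_c P), pair_symmetric (Vhat_e P) &
    forall A B : 'I_N, A != B ->
    [/\ forall x : R, 0 < x -> Vhat P A B x = Vhat_c P A B x + Vhat_e P A B x,
        differentiable_pos 2 (Vhat_c P A B),
        differentiable_pos 2 (Vhat_e P A B),
        forall x : R, 0 < x -> 0 <= derive1n 2 (Vhat_c P A B) x &
        forall x : R, 0 < x -> derive1n 2 (Vhat_e P A B) x <= 0]].

Definition fourth_derivative_split (R : realType) (N : nat)
    (P : potentials R N) : Prop :=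
  [/\ pair_symmetric (Vhat_p P), pair_symmetric (Vhat_m P) &
    forall A B : 'I_N, A != B ->
    [/\ forall x : R, 0 < x -> Vhat P A B x = Vhat_p P A B x + Vhat_m P A B x,
        differentiable_pos 4 (Vhat_p P A B),
        differentiable_pos 4 (Vhat_m P A B),
        forall x : R, 0 < x -> 0 <= derive1n 4 (Vhat_p P A B) x &
        forall x : R, 0 < x -> derive1n 4 (Vhat_m P A B) x <= 0]].

Inductive integrator :=
  | Midpoint
  | LaBuddeGreenspan
  | GeneralizedEyre
  | PerturbedMidpoint
  | PerturbedTrapezoidal.

Definition midpoint (R : realType) (N k : nat) (x x' : 'I_N -> 'rV[R]_k)
    (A : 'I_N) : 'rV[R]_k :=
  2^-1 *: (x A + x' A).

Definition dist (R : realType) (N : nat) (q : 'I_N -> 'rV[R]_3)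
    (A B : 'I_N) : R :=
  enorm (q A - q B).

Definition force (R : realType) (N : nat) (s : integrator)
    (P : potentials R N) (dt : R) (q q' : 'I_N -> 'rV[R]_3)
    (A B : 'I_N) : 'rV[R]_3 :=
  let e := midpoint q q' A - midpoint q q' B in
  let d := dist q A B in
  let d' := dist q' A B in
  let dm := dist (midpoint q q') A B in
  match s with
  | Midpoint =>
      (dt * derive1 (Vhat P A B) dm / dm) *: e
  | LaBuddeGreenspan =>
      (2 * dt * ((Vhat P A B d' - Vhat P A B d) / (d' - d)) / (d' + d)) *: e
  | GeneralizedEyre =>
      (2 * dt * (derive1 (Vhat_c P A B) d' + derive1 (Vhat_e P A B) d)
       / (d' + d)) *: e
  | PerturbedMidpoint =>
      (2 * dt * (derive1 (Vhat P A B) ((d' + d) / 2)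
                 + (d' - d) ^+ 2 / 24
                   * (derive1n 3 (Vhat_p P A B) d'
                      + derive1n 3 (Vhat_m P A B) d))
       / (d' + d)) *: e
  | PerturbedTrapezoidal =>
      (2 * dt * ((derive1 (Vhat P A B) d' + derive1 (Vhat P A B) d) / 2
                 - (d' - d) ^+ 2 / 12
                   * (derive1n 3 (Vhat_p P A B) d
                      + derive1n 3 (Vhat_m P A B) d'))
       / (d' + d)) *: e
  end.

Definition force_well_defined (R : realType) (N : nat) (s : integrator)
    (q q' : 'I_N -> 'rV[R]_3) : Prop :=
  forall A B : 'I_N, A != B ->
  [/\ 0 < dist q A B, 0 < dist q' A B &
    match s with
    | Midpoint => 0 < dist (midpoint q q') A B
    | LaBuddeGreenspan => dist q' A B <> dist q A B
    | _ => True
    end].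

Definition integrator_step (R : realType) (N : nat) (s : integrator)
    (m : 'M[R]_N) (P : potentials R N) (dt : R)
    (q p q' p' : 'I_N -> 'rV[R]_3) : Prop :=
  (forall A : 'I_N,
     q' A - q A = dt *: \sum_(B < N) invmx m A B *: midpoint p p' B) /\
  (forall A : 'I_N,
     p' A - p A = - \sum_(B < N | B != A) force s P dt q q' A B).

Definition linear_momentum (R : realType) (N : nat)
    (q p : 'I_N -> 'rV[R]_3) : 'rV[R]_3 :=
  \sum_(A < N) p A.

Definition center_of_mass (R : realType) (N : nat) (m : 'M[R]_N)
    (q p : 'I_N -> 'rV[R]_3) (t : R) : 'rV[R]_3 :=
  (\sum_(A < N) \sum_(B < N) m A B)^-1 *:
  (\sum_(A < N) \sum_(B < N) m A B *: q B - t *: linear_momentum q p).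

(* Main.v *)
(* The force on A from B is a scalar multiple of e_AB, and the scalar is symmetric
   in A and B, so the forces are pairwise opposite and their total vanishes;
   hence L is conserved.  Multiplying the position update by the (invertible)
   mass matrix and summing over all particles, the mass-weighted displacement is
   dt times the mean of L_n and L_(n+1), i.e. dt L, which is exactly what the
   term t L of the center of mass subtracts. *)

Require Import Defs.
From mathcomp Require Import all_boot all_order all_algebra.
From mathcomp Require Import all_classical all_reals all_analysis.
Import Order.TTheory GRing.Theory Num.Theory.
Import numFieldNormedType.Exports.
Local Open Scope ring_scope.

(** Swapping the two summations and applying antisymmetry turns the sum [S] into [- S], so
    [2 *: S = 0], and 2 is nonzero in [R]. *)
Lemma sum_antisymmetric (R : numFieldType) (V : lmodType R) (I : finType)
    (F : I -> I -> V) :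
  (forall i j, i != j -> F i j = - F j i) -> \sum_i \sum_(j | j != i) F i j = 0.
Proof.
move=> F_anti; set S := LHS.
have SN : S = - S.
  rewrite {1}/S (exchange_big_dep predT) //= -sumrN; apply: eq_bigr => j _.
  rewrite -sumrN; apply: eq_big => [i|i]; first by rewrite eq_sym.
  by rewrite eq_sym; exact: F_anti.
have : 2%:R *: S = 0 by rewrite scaler_nat mulr2n {2}SN subrr.
by move/eqP; rewrite scaler_eq0 pnatr_eq0 /= => /eqP.
Qed.

Lemma posdefmx_unit (R : realType) (N : nat) (m : 'M[R]_N) :
  posdefmx m -> m \in unitmx.
Proof.
move=> m_pos; rewrite unitmxE unitfE; apply/det0P => -[x x0 xm].
by have := m_pos _ x0; rewrite xm mul0mx mxE ltxx.
Qed.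

(** The half-line is open, so by induction the [k]-th derivatives agree on a neighbourhood of each
    [x > 0]. This carries pair symmetry over to derivatives. *)
Lemma derive1n_eq_pos (R : realType) (f g : R -> R) (k : nat) :
  (forall x, 0 < x -> f x = g x) ->
  forall x, 0 < x -> derive1n k f x = derive1n k g x.
Proof.
move=> fg; elim: k => [|k IHk] x x0; first exact: fg.
rewrite !derive1nS !derive1E; apply: near_eq_derive.
by apply: filterS (lt_nbhsr x0) => y; exact: IHk.
Qed.

Lemma derive1n_pair_symmetric (R : realType) (N : nat)
    (W : 'I_N -> 'I_N -> R -> R) (k : nat) :
  pair_symmetric W -> pair_symmetric (fun A B => derive1n k (W A B)).
Proof.
by move=> W_sym A B x AB; apply: derive1n_eq_pos => y; exact: W_sym.
Qed.

Lemma distC (R : realType) (N : nat) (q : 'I_N -> 'rV[R]_3) (A B : 'I_N) :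
  dist q A B = dist q B A.
Proof.
rewrite /dist /enorm -opprB; congr Num.sqrt.
by apply: eq_bigr => i _; rewrite mxE sqrrN.
Qed.

Lemma forceC (R : realType) (N : nat) (s : integrator) (P : potentials R N)
    (dt : R) (q q' : 'I_N -> 'rV[R]_3) (A B : 'I_N) :
  pair_symmetric (Vhat P) -> pair_symmetric (Vhat_c P) ->
  pair_symmetric (Vhat_e P) -> pair_symmetric (Vhat_p P) ->
  pair_symmetric (Vhat_m P) -> force_well_defined s q q' -> A != B ->
  force s P dt q q' A B = - force s P dt q q' B A.
Proof.
move=> V_sym c_sym e_sym p_sym m_sym wd AB; have [d0 d'0 ds] := wd A B AB.
have V1 x : 0 < x -> derive1 (Vhat P A B) x = derive1 (Vhat P B A) x.
  exact: (derive1n_pair_symmetric _ _ _ 1 V_sym).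
have c1 x : 0 < x -> derive1 (Vhat_c P A B) x = derive1 (Vhat_c P B A) x.
  exact: (derive1n_pair_symmetric _ _ _ 1 c_sym).
have e1 x : 0 < x -> derive1 (Vhat_e P A B) x = derive1 (Vhat_e P B A) x.
  exact: (derive1n_pair_symmetric _ _ _ 1 e_sym).
have p3 x : 0 < x -> derive1n 3 (Vhat_p P A B) x = derive1n 3 (Vhat_p P B A) x.
  exact: (derive1n_pair_symmetric _ _ _ 3 p_sym).
have m3 x : 0 < x -> derive1n 3 (Vhat_m P A B) x = derive1n 3 (Vhat_m P B A) x.
  exact: (derive1n_pair_symmetric _ _ _ 3 m_sym).
(* Symmetry of the potentials holds only at positive arguments; this covers the mean distance of the
   perturbed mid-point force. *)
have mean0 : 0 < (dist q' A B + dist q A B) / 2.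
  by rewrite divr_gt0 ?addr_gt0.
rewrite /force !(distC _ _ _ B A).
have flip a b (u v : 'rV[R]_3) : a = b -> a *: (u - v) = - (b *: (v - u)).
  by move=> ->; rewrite -scalerN opprB.
(* [flip] reduces each case to symmetry of the scalar factor; for [Midpoint], [ds] supplies
   positivity of the mid-point distance. *)
case: s wd ds => _ ds; apply: flip.
- by rewrite (V1 _ ds).
- by rewrite !(V_sym A B).
- by rewrite (c1 _ d'0) (e1 _ d0).
- by rewrite (V1 _ mean0) (p3 _ d'0) (m3 _ d0).
- by rewrite (V1 _ d'0) (V1 _ d0) (p3 _ d0) (m3 _ d'0).
Qed.

Lemma sum_midpoint (R : realType) (N k : nat) (x x' : 'I_N -> 'rV[R]_k) :
  \sum_A midpoint x x' A = 2^-1 *: (\sum_A x A + \sum_A x' A).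
Proof. by rewrite -scaler_sumr big_split. Qed.

(** This is [m (m^-1 v) = v] for a family of vectors: after exchanging sums, the coefficient of
    [v C] is an entry of the identity matrix. *)
Lemma mass_weighted_inverse (R : comUnitRingType) (V : lmodType R) (N : nat)
    (m : 'M[R]_N) (v : 'I_N -> V) (A : 'I_N) :
  m \in unitmx ->
  \sum_B m A B *: (\sum_C invmx m B C *: v C) = v A.
Proof.
move=> m_unit; under eq_bigr do rewrite scaler_sumr.
rewrite exchange_big /=.
transitivity (\sum_C (1%:M : 'M[R]_N) A C *: v C).
  apply: eq_bigr => C _; rewrite -(mulmxV m_unit) mxE scaler_suml.
  by apply: eq_bigr => B _; rewrite scalerA.
rewrite (bigD1 A) //= mxE eqxx scale1r big1 ?addr0 // => C CA.
by rewrite mxE eq_sym (negbTE CA) scale0r.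
Qed.

Theorem proposition9 (R : realType) (N : nat) (hN : (0 < N)%N)
    (m : 'M[R]_N) (m_sym : m^T = m) (m_posdef : posdefmx m)
    (P : potentials R N) (V_sym : pair_symmetric (Vhat P))
    (V_ce : convex_concave_split P) (V_pm : fourth_derivative_split P)
    (s : integrator) (tn tn1 : R) (htn : tn < tn1)
    (qn pn qn1 pn1 : 'I_N -> 'rV[R]_3)
    (well_defined : force_well_defined s qn qn1)
    (step : integrator_step s m P (tn1 - tn) qn pn qn1 pn1) :
  linear_momentum qn1 pn1 = linear_momentum qn pn /\
  center_of_mass m qn1 pn1 tn1 = center_of_mass m qn pn tn.
Proof.
have [q_step p_step] := step.
have [c_sym e_sym _] := V_ce; have [p_sym pm_sym _] := V_pm.
have L_cons : linear_momentum qn1 pn1 = linear_momentum qn pn.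
  apply/eqP; rewrite -subr_eq0 /linear_momentum -sumrB.
  under eq_bigr do rewrite p_step.
  rewrite sumrN sum_antisymmetric ?oppr0 // => A B AB.
  exact: forceC.
split=> //; rewrite /center_of_mass L_cons; congr (_ *: _).
have displacement : \sum_A \sum_B m A B *: qn1 B - \sum_A \sum_B m A B *: qn B
    = (tn1 - tn) *: linear_momentum qn pn.
  rewrite -sumrB.
  transitivity (\sum_A (tn1 - tn) *: midpoint pn pn1 A).
    apply: eq_bigr => A _; rewrite -sumrB.
    have m_unit := posdefmx_unit _ _ _ m_posdef.
    rewrite -(mass_weighted_inverse _ _ _ m (midpoint pn pn1) A m_unit).
    rewrite scaler_sumr; apply: eq_bigr => B _.
    by rewrite -scalerBr q_step scalerA mulrC -scalerA.
  rewrite -scaler_sumr sum_midpoint.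
  (* Conservation of momentum makes the mean of the old and new total momenta equal to the old
     one. *)
  rewrite -[\sum_A pn1 A]/(linear_momentum qn1 pn1) L_cons.
  congr (_ *: _); rewrite -mulr2n.
  by rewrite -[X in _ *: X]scaler_nat scalerA mulVf ?pnatr_eq0 // scale1r.
(* The [tn1] part of the displacement cancels the subtracted [tn1 *: L], which leaves the numerator
   at [tn]. *)
move/eqP: displacement; rewrite subr_eq scalerBl => /eqP ->.
by rewrite addrAC [X in X + _]addrAC subrr sub0r addrC.
Qed.
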